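(* For every positive integer $a$, we have the identity of formal power series \[P_a(q) =\sum_{n=1}^\infty \mu(n)\,\widehat{P}_{an}(q),\] and for all positive integers $a$ and $n$, \[p_a(n) = \sum_{j=1}^\infty \mu(j)\,\widehat{p}_{aj}(n),\] where $\mu$ denotes the Möbius function.
   Context: For positive integers $a$ and $n$, $p_a(n)$ denotes the number of partitions of $n$ into (exactly) $a$ parts, and $\widehat{p}_a(n)$ denotes the number of partitions of $n$ into $ak$ parts for some integer $k\geq 1$, i.e. \[\widehat{p}_a(n) := \sum_{j=1}^\infty p_{aj}(n)\] (a sum with only finitely many nonzero terms). Their generating functions are the formal power series \[P_a(q):=\sum_{n=1}^\infty p_a(n)q^n,\qquad \widehat{P}_a(q):=\sum_{n=1}^\infty \widehat{p}_a(n)q^n.\] Infinite sums of formal power series are taken coefficientwise. *)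

(* Defs.v *)
From mathcomp Require Import all_boot all_order all_algebra finmap.
From mathcomp Require Import boolp classical_sets functions cardinality fsbigop.

Set Implicit Arguments.
Unset Strict Implicit.
Unset Printing Implicit Defensive.

Import GRing.Theory.
Local Open Scope classical_set_scope.
Local Open Scope ring_scope.

Definition is_partition (a n : nat) (s : seq nat) : bool :=
  [&& sorted geq s, all (ltn 0) s, size s == a & sumn s == n].

(* Every part of a partition of n is at most n, so the a-tuples over 'I_n.+1
   give all partitions of n into a parts; see npartP. *)
Definition npart (a n : nat) : nat :=
  #|[set t : a.-tuple 'I_n.+1 | is_partition a n (map val t)]%SET|.

Definition posn : set nat := [set j : nat | (0 < j)%N].

(* The terms with a * j > n vanish, so this is a genuine finite sum; see
   phat_support_finite. *)
Definition phat (a n : nat) : nat :=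
  \big[addn/0%N]_(j \in posn) npart (a * j) n.

(* The value at 0 is irrelevant and set to 0. *)
Definition moebius (n : nat) : int :=
  if (0 < n)%N && all (fun p => logn p n == 1%N) (primes n)
  then (-1) ^+ size (primes n) else 0.

(* Formal power series over int, as coefficient sequences; the module
   structure is the pointwise one. *)
Definition fps : Type := nat -> int^o.

Definition npart_gf (a : nat) : fps :=
  fun n => if (0 < n)%N then (npart a n)%:Z else 0.

Definition phat_gf (a : nat) : fps :=
  fun n => if (0 < n)%N then (phat a n)%:Z else 0.

(* Sums over an infinite set have the default value 0 when infinitely many
   terms are nonzero; [summable_pos] and [fps_summable_pos] exclude this. *)
Definition summable_pos (F : nat -> int) : Prop :=
  finite_set [set j | posn j /\ F j != 0].

Definition sum_pos (F : nat -> int) : int := \sum_(j \in posn) F j.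

Definition fps_summable_pos (F : nat -> fps) : Prop :=
  forall k : nat, summable_pos (fun n => F n k).

Definition fps_sum_pos (F : nat -> fps) : fps :=
  fun k => sum_pos (fun n => F n k).

Lemma npartP (a n : nat) :
  exists S : seq (seq nat),
    [/\ uniq S, (forall s, (s \in S) = is_partition a n s)
      & size S = npart a n].
Proof.
exists [seq map val (val t)
  | t <- enum [set t : a.-tuple 'I_n.+1 | is_partition a n (map val t)]%SET].
split; last by rewrite size_map -cardE.
- rewrite map_inj_uniq ?enum_uniq //.
  by move=> t u /(inj_map val_inj)/val_inj.
- move=> s; apply/mapP/idP => [[t]|ps].
    by rewrite mem_enum inE => pt ->.
  have lesn : all (fun x => x < n.+1)%N s.
    case/and4P: ps => _ _ _ /eqP <-; elim: s => //= x s IHs.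
    rewrite ltnS leq_addr /=; apply: sub_all IHs => y.
    by rewrite !ltnS => /leq_trans; apply; rewrite leq_addl.
  have sz : size (map (@inord n) s) == a.
    by rewrite size_map; case/and4P: ps.
  have sE : s = map val (map (@inord n) s).
    rewrite -map_comp -[LHS]map_id; apply/eq_in_map => x xs /=.
    by rewrite inordK // (allP lesn).
  by exists (Tuple sz); rewrite ?mem_enum ?inE /= -sE.
Qed.

Lemma npart_eq0 (a n : nat) : (n < a)%N -> npart a n = 0%N.
Proof.
move=> na; apply/eqP; rewrite cards_eq0; apply/eqP/setP => t; rewrite !inE.
apply/negP => /and4P[_ pos /eqP sz /eqP sm]; move: na.
rewrite ltnNge -{}sm -{1}sz; case/negP; elim: (map _ _) pos => //= x s IHs.
by case/andP=> x0 /IHs h; rewrite -add1n leq_add.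
Qed.

Lemma phat_support_finite (a n : nat) : (0 < a)%N ->
  finite_set [set j | posn j /\ npart (a * j) n != 0%N].
Proof.
move=> a0; apply: (sub_finite_set _ (finite_II n.+1)) => j /= [_].
rewrite ltnS; apply: contraR; rewrite -ltnNge => nj.
by rewrite npart_eq0 // (leq_trans nj) // leq_pmull.
Qed.

(* Main.v *)
(* Moebius inversion on the multiples of a: expanding the definition of
   the p-hat's and collecting the terms by the product m = j * k turns the
   right-hand side into the sum over m of p_(a m)(n) times the sum of mu over
   the divisors of m, and the latter vanishes unless m = 1. Summability holds
   since p_b(n) = 0 for b > n. *)
Require Import Defs.
From mathcomp Require Import all_boot all_order all_algebra.
From mathcomp Require Import boolp classical_sets functions cardinality fsbigop.

Import GRing.Theory.

Local Open Scope ring_scope.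

Lemma moebius1 : moebius 1 = 1.
Proof. by []. Qed.

(** The primes of [p * e] are those of [e], with unchanged exponents, and [p] with exponent 1:
    squarefreeness is unaffected and the sign gains one factor -1. *)
Lemma moebius_mul_prime_ndvd (p e : nat) :
  prime p -> (0 < e)%N -> ~~ (p %| e)%N -> moebius (p * e) = - moebius e.
Proof.
move=> pp e0 npe; have p0 := prime_gt0 pp.
have pe : p \notin primes e by rewrite mem_primes pp e0.
have perm : perm_eq (primes (p * e)) (p :: primes e).
  apply: uniq_perm => [||q]; rewrite /= ?primes_uniq ?pe //.
  by rewrite primesM // primes_prime // !inE.
rewrite /moebius muln_gt0 p0 e0 /= (perm_all _ perm) (perm_size perm) /=.
have lp : logn p e = 0%N by apply/eqP; rewrite -leqn0 leqNgt logn_gt0.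
rewrite lognM // lp logn_prime // eqxx /=.
rewrite (eq_in_all (a2 := fun q => logn q e == 1%N)) => [|q qe].
  by case: ifP => _; rewrite ?oppr0 // exprS mulN1r.
rewrite lognM // logn_prime //; case: (eqVneq q p) => // qp.
by rewrite -qp qe in pe.
Qed.

(** The exponent of [p] in [p * e] is at least 2; the case [e = 0] rests on the value 0 of [moebius]
    at 0. *)
Lemma moebius_mul_prime_dvd (p e : nat) :
  prime p -> (p %| e)%N -> moebius (p * e) = 0.
Proof.
move=> pp; case: (posnP e) => [-> _|e0 pe]; first by rewrite muln0.
have p0 := prime_gt0 pp; rewrite /moebius muln_gt0 p0 e0 /=.
case: ifP => // /allP/(_ p); rewrite mem_primes pp muln_gt0 p0 e0 dvdn_mulr //.
move=> /(_ isT); rewrite lognM // logn_prime // eqxx -[X in _ == X]addn0 eqn_add2l.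
by rewrite -leqn0 leqNgt logn_gt0 mem_primes pp e0 pe.
Qed.

(* For a prime p dividing n, d |-> p * d pairs off the divisors d of n prime
   to p with those divisible exactly once by p, with opposite values of mu. *)
Lemma sum_moebius_divisors (n : nat) :
  (0 < n)%N -> \sum_(d <- divisors n) moebius d = (n == 1%N)%:R.
Proof.
move=> n0; case: eqP => [->|/eqP n1]; first by rewrite big_seq1 moebius1.
have pp : prime (pdiv n) by rewrite pdiv_prime // ltn_neqAle eq_sym n1.
move: (pdiv n) pp (pdiv_dvd n) => p pp pn.
have p0 := prime_gt0 pp.
have [m En] := dvdnP pn; rewrite mulnC in En.
have m0 : (0 < m)%N by move: n0; rewrite En muln_gt0 => /andP[].
rewrite (bigID (fun d => p %| d)%N) /=.
have perm : perm_eq [seq d <- divisors n | (p %| d)%N]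
                    [seq (p * e)%N | e <- divisors m].
  apply: uniq_perm => [||d].
  - by rewrite filter_uniq ?divisors_uniq.
  - rewrite map_inj_uniq ?divisors_uniq // => x y /eqP.
    by rewrite eqn_pmul2l // => /eqP.
  rewrite mem_filter -dvdn_divisors //.
  apply/andP/mapP => [[/dvdnP[e ->]]|[e]].
    rewrite En mulnC dvdn_pmul2l // => em.
    by exists e; rewrite // -dvdn_divisors.
  by rewrite -dvdn_divisors // => em ->; rewrite dvdn_mulr // En dvdn_pmul2l.
(* By Gauss's lemma, a number prime to [p] divides [n = p * m] exactly when it divides [m]. *)
have perm' : perm_eq [seq d <- divisors n | ~~ (p %| d)%N]
                     [seq e <- divisors m | ~~ (p %| e)%N].
  apply: uniq_perm => [||d]; rewrite ?filter_uniq ?divisors_uniq //.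
  rewrite !mem_filter -!dvdn_divisors //; case: (boolP (p %| d)%N) => //= pd.
  by rewrite En Gauss_dvdr // coprime_sym prime_coprime.
rewrite -big_filter (perm_big _ perm) big_map -[X in _ + X]big_filter.
rewrite (perm_big _ perm') big_filter /= [X in X + _]big_seq.
(* Both sums now run over the divisors [e] of [m]. In the first, the [e] divisible by [p] contribute
   0; the others cancel termwise against the second. *)
rewrite [X in X + _](bigID (fun e => p %| e)%N) /= big1 ?add0r.
  rewrite [X in _ + X]big_seq_cond -big_split /= big1 // => e.
  rewrite -dvdn_divisors // => /andP[em pe].
  by rewrite moebius_mul_prime_ndvd // ?addNr // (dvdn_gt0 m0).
by move=> e /andP[_]; apply: moebius_mul_prime_dvd.
Qed.

Lemma big_posn_nat (R : Type) (idx : R) (op : Monoid.com_law idx)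
    (N : nat) (F : nat -> R) :
  (forall j, (N < j)%N -> F j = idx) ->
  \big[op/idx]_(j \in posn) F j = \big[op/idx]_(1 <= j < N.+1) F j.
Proof.
move=> F0; rewrite (fsbigE (index_iota 1 N.+1)) ?iota_uniq //.
- rewrite big_seq_cond [RHS]big_seq; apply: eq_bigl => j; rewrite mem_index_iota.
  by apply: andb_idr => /andP[j0 _]; apply/mem_set.
- by move=> j /=; rewrite mem_index_iota => /andP[].
by move=> j /= j0; rewrite mem_index_iota j0 /= ltnS -ltnNge => /F0.
Qed.

(** Substituting [m = j * k] gives a range for [m] that depends on [j] only through divisibility,
    which prepares the exchange of summations. *)
Lemma phat_mul_dvd (a j n : nat) : (0 < a)%N -> (0 < j)%N ->
  phat (a * j) n = (\sum_(1 <= m < n.+1 | j %| m) npart (a * m) n)%N.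
Proof.
(* The cutoff [n %/ j] is the largest [k] with [j * k <= n]; beyond it [a * j * k] exceeds [n]. *)
move=> a0 j0; rewrite /phat (big_posn_nat _ _ _ (n %/ j)) => [|k].
  have perm : perm_eq [seq m <- index_iota 1 n.+1 | (j %| m)%N]
                      [seq (j * k)%N | k <- index_iota 1 (n %/ j).+1].
    apply: uniq_perm => [||m].
    - by rewrite filter_uniq ?iota_uniq.
    - rewrite map_inj_uniq ?iota_uniq // => x y /eqP.
      by rewrite eqn_pmul2l // => /eqP.
    rewrite mem_filter mem_index_iota ltnS.
    apply/andP/mapP => [[/dvdnP[k ->]]|[k]].
      rewrite muln_gt0 => /andP[/andP[k0 _] kn]; exists k; last by rewrite mulnC.
      by rewrite mem_index_iota k0 ltnS leq_divRL.
    rewrite mem_index_iota ltnS leq_divRL // => /andP[k0 kn] ->.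
    by rewrite dvdn_mulr // muln_gt0 j0 k0 mulnC.
  rewrite -[RHS]big_filter (perm_big _ perm) big_map.
  by apply: eq_bigr => k _; rewrite mulnA.
rewrite ltn_divLR // => nk; rewrite npart_eq0 // (leq_trans nk) //.
by rewrite -mulnA [(j * k)%N]mulnC leq_pmull.
Qed.

Lemma phat_eq0 (a n : nat) : (0 < a)%N -> (n < a)%N -> phat a n = 0%N.
Proof.
move=> a0 na; rewrite /phat fsbig1 // => j j0.
by rewrite npart_eq0 // (leq_trans na) // leq_pmulr.
Qed.

Lemma npart_moebius_inversion (a n : nat) : (0 < a)%N -> (0 < n)%N ->
  (npart a n)%:Z =
  \sum_(1 <= j < n.+1) moebius j * (phat (a * j) n)%:Z.
Proof.
move=> a0 n0.
transitivity (\sum_(1 <= j < n.+1) \sum_(1 <= m < n.+1 | (j %| m)%N)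
                 moebius j * (npart (a * m) n)%:Z); last first.
  apply: eq_big_nat => j /andP[j0 _]; rewrite phat_mul_dvd // -mulr_sumr.
  by rewrite (big_morph Posz PoszD erefl).
rewrite (exchange_big_dep xpredT) //=.
(* After the exchange, the inner sum is that of [moebius] over the divisors of [m]. The term [m = 1]
   lies in the range because [n] is positive. *)
transitivity (\sum_(1 <= m < n.+1) (m == 1%N)%:R * (npart (a * m) n)%:Z).
  rewrite big_nat_recl // muln1 mul1r big_nat big1 ?addr0 // => m /andP[m0 _].
  by rewrite eqSS -leqn0 leqNgt m0 mul0r.
apply: eq_big_nat => m /andP[m0 mn]; rewrite -mulr_suml; congr (_ * _).
(* Since [m <= n], the range of [j] contains every divisor of [m]. *)
rewrite -sum_moebius_divisors // -[RHS]big_filter; apply/esym/perm_big.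
apply: uniq_perm => [||d]; rewrite ?filter_uniq ?divisors_uniq ?iota_uniq //.
rewrite mem_filter mem_index_iota -dvdn_divisors //.
case: (boolP (d %| m)%N) => //= dm.
by rewrite (dvdn_gt0 m0) // (leq_ltn_trans (dvdn_leq _ dm)).
Qed.

Lemma moebius_phat_eq0 (a n j : nat) : (0 < a)%N -> (n < j)%N ->
  moebius j * (phat (a * j) n)%:Z = 0.
Proof.
move=> a0 nj; have naj : (n < a * j)%N by rewrite (leq_trans nj) // leq_pmull.
by rewrite phat_eq0 ?mulr0 // (leq_ltn_trans _ naj).
Qed.

Lemma summable_pos_moebius_phat (a n : nat) : (0 < a)%N ->
  summable_pos (fun j => moebius j * (phat (a * j) n)%:Z).
Proof.
move=> a0; apply: (sub_finite_set _ (finite_II n.+1)) => j /= [_].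
by apply: contraR; rewrite -leqNgt => /(moebius_phat_eq0 _ _ _ a0) ->.
Qed.

Lemma npart_sum_pos (a n : nat) : (0 < a)%N -> (0 < n)%N ->
  (npart a n)%:Z = sum_pos (fun j => moebius j * (phat (a * j) n)%:Z).
Proof.
move=> a0 n0; rewrite /sum_pos (big_posn_nat _ _ _ n).
  exact: npart_moebius_inversion.
by move=> j; apply: moebius_phat_eq0.
Qed.

Theorem theorem1p2 :
  (forall a : nat, (0 < a)%N ->
     fps_summable_pos (fun n : nat => moebius n *: phat_gf (a * n)) /\
     npart_gf a = fps_sum_pos (fun n : nat => moebius n *: phat_gf (a * n))) /\
  (forall a n : nat, (0 < a)%N -> (0 < n)%N ->
     summable_pos (fun j : nat => moebius j * (phat (a * j) n)%:Z) /\
     (npart a n)%:Z = sum_pos (fun j : nat => moebius j * (phat (a * j) n)%:Z)).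
Proof.
split=> [a a0|a n a0 n0]; last first.
  by split; [exact: summable_pos_moebius_phat | exact: npart_sum_pos].
(* Scaling is pointwise, so the series identity at index [k > 0] is the numerical one, while at
   [k = 0] both sides are 0. *)
have coefE k : (fun n => (moebius n *: phat_gf (a * n)) k) =
    if (0 < k)%N then fun j => moebius j * (phat (a * j) k)%:Z else fun=> 0.
  apply/funext => j; rewrite -[LHS]/(moebius j * phat_gf (a * j) k).
  by rewrite /phat_gf; case: ifP; rewrite ?mulr0.
split=> [k|].
  rewrite coefE; case: ifP => _; first exact: summable_pos_moebius_phat.
  by apply: (sub_finite_set _ (finite_set0 nat)) => j /= [_].
apply/funext => k; rewrite /fps_sum_pos coefE /npart_gf; case: ifP => k0.
  exact: npart_sum_pos.
by rewrite /sum_pos fsbig1.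
Qed.
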